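(* Let $\mathbb K\in\{\mathbb R,\mathbb C\}$ and let $X\subseteq\mathbb K^n$ be an analytic set with $0\in X$. If $X$ is a smooth analytic submanifold near $0$, then for every $u\in T_0X\setminus\{0\}$ the set $X$ is second-order realizable along $u$. Consequently, $$T^2_{0,u}X=T^{2,a}_{0,u}X .$$
   Context: An analytic function is one that is locally given by convergent power series (real-analytic for $\mathbb K=\mathbb R$, holomorphic for $\mathbb K=\mathbb C$). An analytic set $X$ in an open set $U\subseteq\mathbb K^n$ is a subset of $U$ such that every $a\in U$ has a neighborhood $V\subseteq U$ on which $X\cap V$ is the common zero set of finitely many analytic functions $V\to\mathbb K$. $\mathcal I(X,0)$ is the ideal of germs at $0$ of analytic functions on $\mathbb K^n$ that vanish on $X\cap V$ for some neighborhood $V$ of $0$. $X$ is a smooth analytic submanifold near $0\in X$ if there is a neighborhood $U$ of $0$ such that $X\cap U$ is an analytic submanifold of $\mathbb K^n$; equivalently, there are an integer $d$ and a local analytic coordinate system near $0$ in which $X\cap U$ becomes $\mathbb K^d\times\{0\}$. Geometric tangent cone: $T_0X$ is the set of $v\in\mathbb K^n$ for which there are $x_k\in X\setminus\{0\}$ and real $t_k>0$ with $x_k\to0$ and $t_kx_k\to v$. For a nonzero germ $f=f_m+f_{m+1}+\cdots$ (power series expansion at $0$ into homogeneous polynomials $f_j$ of degree $j$, with $f_m\not\equiv0$), $f^{[*]}:=f_m$ is the initial form and $f^{[*]+1}:=f_{m+1}$ (possibly zero). $T^2_{0,u}X$ is the set of all $w\in\mathbb K^n$ for which there are positive real numbers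 $t_k\downarrow0$ and $w_k\in\mathbb K^n$ with $w_k\to w$ such that $t_ku+\frac12t_k^2w_k\in X$ for every $k$. $T^{2,a}_{0,u}X:=\{w\in\mathbb K^n:\ \tfrac12\langle\nabla f^{[*]}(u),w\rangle+f^{[*]+1}(u)=0\ \text{ for all nonzero } f\in\mathcal I(X,0)\}$, where $\nabla$ is the vector of partial derivatives over $\mathbb K$ and $\langle a,b\rangle=\sum_i a_ib_i$ (bilinear). $X$ is second-order realizable along $u$ if for every $w\in T^{2,a}_{0,u}X$ there exist $\varepsilon>0$ and an analytic curve $\gamma:(0,\varepsilon)\to X$ such that $\gamma(t)=tu+\frac12t^2w+o(t^2)$ as $t\to0^+$. A curve on the real interval $(0,\varepsilon)$ is analytic if near each point its components are given by convergent power series in $t$ with coefficients in $\mathbb K$. *)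

(* Defs.v *)
From HB Require Import structures.
From mathcomp Require Import all_boot all_order all_algebra.
From mathcomp Require Import all_classical all_reals all_analysis.
From mathcomp Require Import complex.
From mathcomp Require mpoly.
(* The notations of mpoly.v clash with those of MathComp-Analysis. *)
Import (canonicals, coercions) mpoly.
Set Implicit Arguments.
Unset Strict Implicit.
Unset Printing Implicit Defensive.

Import Order.TTheory GRing.Theory Num.Theory.
Import numFieldNormedType.Exports.

Local Open Scope ring_scope.
Local Open Scope classical_set_scope.

Notation mpolynomial K n := (mpoly.mpoly n K).

Variant scalar_kind := RealScalars | ComplexScalars.

Definition scalars (R : realType) (s : scalar_kind) : numFieldType :=
  match s with RealScalars => R | ComplexScalars => R[i] end.

Definition of_real (R : realType) (s : scalar_kind) : R -> scalars R s :=
  match s with RealScalars => id | ComplexScalars => real_complex R end.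

Section Analytic.
Context {K : numFieldType} {n : nat}.
Implicit Types (f : 'rV[K]_n -> K) (a x : 'rV[K]_n) (V M : set 'rV[K]_n).

(* [P j] is the part of degree [j] of the power series, so the series
   converges absolutely on the closed polydisc of radius [r] around [a] iff
   the sum of |c_m| r^|m| over all multi-indices [m], grouped by degree, is
   finite. *)
Definition power_series_expansion f a (P : nat -> mpolynomial K n) : Prop :=
  (forall j, P j \is mpoly.ishomog1 j mpoly.mdeg) /\
  exists r : K, [/\ 0 < r,
    cvgn (series (fun j =>
      \sum_(m <- mpoly.msupp (P j)) `|mpoly.mcoeff m (P j)| * r ^+ j)) &
    forall x, (forall i, `|x 0 i - a 0 i| < r) ->
      series (fun j => mpoly.meval ((x - a) 0) (P j)) @ \oo --> f x].

Definition analytic_at f a : Prop := exists P, power_series_expansion f a P.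

(* For [V] open, the values of [f] outside [V] are irrelevant. *)
Definition analytic_on V f : Prop := forall a, V a -> analytic_at f a.

Definition analytic_map_on V (phi : 'rV[K]_n -> 'rV[K]_n) : Prop :=
  forall i, analytic_on V (fun x => phi x 0 i).

Definition analytic_set_in (U X : set 'rV[K]_n) : Prop :=
  X `<=` U /\
  forall a, U a -> exists V, [/\ open_nbhs a V, V `<=` U &
    exists fs : seq ('rV[K]_n -> K),
      (forall k, (k < size fs)%N -> analytic_on V (nth (fun=> 0) fs k)) /\
      forall x, V x ->
        (X x <-> forall k, (k < size fs)%N -> nth (fun=> 0) fs k x = 0)].

(* K^d x {0} in K^n *)
Definition coordinate_subspace (d : nat) : set 'rV[K]_n :=
  [set y | forall i : 'I_n, (d <= i)%N -> y 0 i = 0].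

Definition analytic_submanifold (d : nat) M : Prop :=
  forall a, M a ->
  exists (V W : set 'rV[K]_n) (phi psi : 'rV[K]_n -> 'rV[K]_n),
    [/\ open_nbhs a V /\ open W,
        analytic_map_on V phi /\ analytic_map_on W psi,
        forall x, V x -> W (phi x) /\ psi (phi x) = x,
        forall y, W y -> V (psi y) /\ phi (psi y) = y &
        phi @` (M `&` V) = coordinate_subspace d `&` W].

Definition smooth_near_0 (X : set 'rV[K]_n) : Prop :=
  exists (U : set 'rV[K]_n) (d : nat),
    [/\ open_nbhs (0 : 'rV[K]_n) U, (d <= n)%N & analytic_submanifold d (X `&` U)].

(* [f] represents a germ in the ideal I(X, 0). *)
Definition vanishing_germ (X : set 'rV[K]_n) f : Prop :=
  analytic_at f 0 /\ \forall x \near (0 : 'rV[K]_n), X x -> f x = 0.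

Definition nonzero_germ f : Prop := ~ \forall x \near (0 : 'rV[K]_n), f x = 0.

(* [Pm] and [Pm1] are the initial form of [f] at 0 and the homogeneous part of
   the next degree. *)
Definition initial_forms f (Pm Pm1 : mpolynomial K n) : Prop :=
  exists (P : nat -> mpolynomial K n) (m : nat),
    [/\ power_series_expansion f 0 P, P m != 0,
        forall j, (j < m)%N -> P j = 0, Pm = P m & Pm1 = P m.+1].

(* The pairing is bilinear, also over the complex numbers. *)
Definition T2a (X : set 'rV[K]_n) (u : 'rV[K]_n) : set 'rV[K]_n :=
  [set w | forall f, vanishing_germ X f -> nonzero_germ f ->
    forall Pm Pm1, initial_forms f Pm Pm1 ->
      2^-1 * (\sum_i mpoly.meval (u 0) (mpoly.mderiv i Pm) * w 0 i)
        + mpoly.meval (u 0) Pm1 = 0].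

End Analytic.

Section Tangent.
Context {R : realType} {s : scalar_kind} {n : nat}.
Local Notation K := (scalars R s).
Local Notation "t %:K" := (@of_real R s t) (at level 2, format "t %:K").
Implicit Types (X : set 'rV[K]_n) (u v w : 'rV[K]_n).

Definition tangent_cone_0 X : set 'rV[K]_n :=
  [set v | exists (x : nat -> 'rV[K]_n) (t : nat -> R),
    [/\ forall k, X (x k) /\ x k != 0, forall k, 0 < t k,
        x @ \oo --> (0 : 'rV[K]_n) &
        (fun k => (t k)%:K *: x k) @ \oo --> v]].

Definition T2 X u : set 'rV[K]_n :=
  [set w | exists (t : nat -> R) (w_ : nat -> 'rV[K]_n),
    [/\ forall k, 0 < t k, {homo t : i j / (i <= j)%N >-> j <= i},
        t @ \oo --> (0 : R), w_ @ \oo --> w &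
        forall k, X ((t k)%:K *: u + (2^-1 * t k ^+ 2)%:K *: w_ k)]].

(* Analyticity on ]0, b[; only the values of [g] there are relevant. *)
Definition analytic_curve (b : R) (g : R -> 'rV[K]_n) : Prop :=
  forall t0 : R, 0 < t0 < b -> forall i,
  exists (c : nat -> K) (r : R), 0 < r /\
    forall t, `|t - t0| < r ->
      series (fun k => c k * (t - t0)%:K ^+ k) @ \oo --> g t 0 i.

Definition second_order_realizable X u : Prop :=
  forall w, T2a X u w ->
  exists (e : R) (g : R -> 'rV[K]_n),
    [/\ 0 < e, analytic_curve e g, forall t : R, 0 < t < e -> X (g t) &
        (t ^- 2)%:K *: (g t - (t%:K *: u + (2^-1 * t ^+ 2)%:K *: w))
          @[t --> 0^'+] --> (0 : 'rV[K]_n)].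

End Tangent.

(* Main.v *)
(** In a chart [phi] with inverse [psi] the set is a coordinate subspace.  Let
    [c t = y0 + t y1 + t^2 y2] be the second-order Taylor polynomial of
    [t |-> phi (t u + t^2 w / 2)].  The coordinates of [phi] that vanish on [X]
    have nonzero linear part, so the tangency of [u] kills the corresponding
    entries of [y1], and the equations defining [T2a], applied to these very
    coordinates, kill those of [y2].  Hence [c] stays in the coordinate subspace
    and [gamma = psi o c] lies in [X]; as [psi] is Lipschitz,
    [gamma t = t u + t^2 w / 2 + o(t^2)].  The inclusion of [T2] in [T2a] is the
    second-order expansion of a germ along [t u + t^2 w_k / 2]. *)
Require Import Defs.
From HB Require Import structures.
From mathcomp Require Import all_boot all_order all_algebra.
From mathcomp Require Import all_classical all_reals all_analysis.
From mathcomp Require Import complex ring.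
From mathcomp Require mpoly.
Import (canonicals, coercions) mpoly.
Set Implicit Arguments.
Unset Strict Implicit.
Unset Printing Implicit Defensive.

Import Order.TTheory GRing.Theory Num.Theory.
Import numFieldNormedType.Exports.

Local Open Scope ring_scope.
Local Open Scope classical_set_scope.

(** * The maximum norm on matrices *)

Lemma ler_coord_mx_norm (K : numFieldType) m n (A : 'M[K]_(m, n)) i j :
  `|A i j| <= `|A|.
Proof.
rewrite [leRHS]/Num.Def.normr /= mx_normE.
(* The norm is a maximum formed among the nonnegative elements of [K], so the entry is first viewed
   there. *)
have -> : `|A i j| = (`|A i j|%:nng)%:num by [].
by rewrite num_le (le_bigmax _ (fun k => `|A k.1 k.2|%:nng) (i, j)).
Qed.

Lemma mx_norm_leP (K : numFieldType) m n (A : 'M[K]_(m, n)) (e : K) :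
  0 <= e -> (forall i j, `|A i j| <= e) -> `|A| <= e.
Proof.
move=> e0 Ae; rewrite [leLHS]/Num.Def.normr /= mx_normE.
have -> : e = (NngNum e0)%:num by [].
by rewrite num_le; apply/bigmax_leP; split=> [|[i j] _]; rewrite -num_le /=.
Qed.

(** * Bounds and limits along a filter *)

Section FilterBounds.
Context {K : numFieldType} {T : Type} {F : set_system T}.

Lemma cvg0_dominated {FF : Filter F} (V : normedModType K) (f : T -> V)
    (g : T -> K) :
  (\forall x \near F, `|f x| <= g x) -> g x @[x --> F] --> (0 : K) ->
  f x @[x --> F] --> (0 : V).
Proof.
move=> fg g0; apply/cvgr0Pnorm_lt => e e0.
move/cvgr0Pnorm_lt : g0 => /(_ e e0) ge; near=> x.
have fgx : `|f x| <= g x by near: x.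
(* The order of [K] may be partial; [g x] is comparable with its norm because it bounds a norm from
   above. *)
rewrite (le_lt_trans fgx)// (le_lt_trans (real_ler_norm _))//.
  by rewrite ger0_real// (le_trans _ fgx).
by near: x.
Unshelve. all: by end_near. Qed.

(** Closed balls are closed. Partial sums fed into it yield remainder estimates; with [B = 0] it
    identifies the limit of an eventually constant function. *)
Lemma cvg_norm_subr_le {FF : ProperFilter F} (f : T -> K) (l c B : K) :
  f x @[x --> F] --> l -> (\forall x \near F, `|f x - c| <= B) ->
  `|l - c| <= B.
Proof.
move=> /cvgrPdist_lt fl fB; apply/ler_addgt0Pr => e e0.
have [x [xe xB]] : exists x, `|l - f x| < e /\ `|f x - c| <= B.
  by apply: (@filter_ex _ F); apply: filterI => //; exact: fl.
rewrite [leRHS]addrC -(subrKA (f x)) (le_trans (ler_normD _ _))//.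
by rewrite lerD// ltW.
Qed.

Lemma cvg_exprn {FF : Filter F} (f : T -> K) (a : K) k :
  f x @[x --> F] --> a -> f x ^+ k @[x --> F] --> a ^+ k.
Proof.
move=> fa; elim: k => [|k IHk].
  by under eq_fun do rewrite expr0; rewrite expr0; exact: cvg_cst.
by under eq_fun do rewrite exprS; rewrite exprS; exact: cvgM.
Qed.

Lemma cvg_coord {FF : Filter F} n (v : T -> 'rV[K]_n) (u : 'rV[K]_n) i :
  v x @[x --> F] --> u -> v x 0 i @[x --> F] --> u 0 i.
Proof.
move=> vu; apply: (cvg_comp v (fun w : 'rV[K]_n => w 0 i) vu).
exact: coord_continuous.
Qed.

Lemma cvg_coordP {FF : Filter F} n (v : T -> 'rV[K]_n) (u : 'rV[K]_n) :
  (forall i, v x 0 i @[x --> F] --> u 0 i) -> v x @[x --> F] --> u.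
Proof.
move=> vu; apply/cvgrPdist_le => e e0.
have : \forall x \near F, forall i, `|u 0 i - v x 0 i| <= e.
  apply: filter_forall => i.
  by move/cvgrPdist_le : (vu i) => /(_ e e0).
apply: filterS => x ve; apply: mx_norm_leP; first exact: ltW.
by move=> i j; rewrite ord1 !mxE.
Qed.

End FilterBounds.

(** * Estimates and derivatives of homogeneous polynomials *)

Section HomogeneousPolynomials.
Context {K : numFieldType} {n : nat}.
Local Notation ev p v := (mpoly.meval (v 0) p).
Implicit Types (p q : mpolynomial K n) (x y u v : 'rV[K]_n).

(** The l^1 norm of the coefficients: summability of [coef_norm (P j) * r ^+ j] is the absolute
    convergence required by [power_series_expansion]. *)
Definition coef_norm p : K :=
  \sum_(m <- mpoly.msupp p) `|mpoly.mcoeff m p|.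

Lemma coef_norm_ge0 p : 0 <= coef_norm p.
Proof. exact: sumr_ge0. Qed.

Lemma sum_mnm_homog j p m : p \is mpoly.ishomog1 j mpoly.mdeg ->
  m \in mpoly.msupp p -> (\sum_i m i)%N = j.
Proof. by move=> /mpoly.dhomogP pj /pj <-; rewrite -mpoly.mdegE. Qed.

Lemma ler_norm_meval j p x (r : K) : p \is mpoly.ishomog1 j mpoly.mdeg ->
  `|x| <= r -> `|ev p x| <= coef_norm p * r ^+ j.
Proof.
move=> pj xr; have r0 := le_trans (normr_ge0 _) xr.
rewrite mpoly.mevalE /coef_norm mulr_suml.
rewrite (le_trans (ler_norm_sum _ _ _))// !big_seq ler_sum// => m pm.
rewrite normrM ler_wpM2l// normr_prod -(sum_mnm_homog pj pm) -prodrXr.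
apply: ler_prod => i _; rewrite normr_ge0 normrX lerXn2r ?nnegrE//=.
by rewrite (le_trans _ xr)// ler_coord_mx_norm.
Qed.

Lemma meval_homogZ j p x (t : K) : p \is mpoly.ishomog1 j mpoly.mdeg ->
  ev p (t *: x) = t ^+ j * ev p x.
Proof.
move=> pj; rewrite !mpoly.mevalE mulr_sumr.
rewrite !big_seq; apply: eq_bigr => m pm; rewrite mulrCA; congr (_ * _).
rewrite -(sum_mnm_homog pj pm) -prodrXr -big_split /=.
by apply: eq_bigr => i _; rewrite mxE exprMn.
Qed.

(* The factor [r] on the left spares the exponent [\sum_i m i - 1]. *)
Lemma ler_dist_prodX (I : finType) (m : I -> nat) (a b : I -> K) (r d : K) :
  0 <= r -> 0 <= d -> (forall i, `|a i| <= r) -> (forall i, `|b i| <= r) ->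
  (forall i, `|a i - b i| <= d) ->
  r * `|\prod_i a i ^+ m i - \prod_i b i ^+ m i| <=
    (\sum_i m i)%:R * r ^+ (\sum_i m i) * d.
Proof.
move=> r0 d0 ar br abd.
(* Sizes and distance are carried together: in [x x' - y y' = x (x' - y') + (x - y) y'] the distance
   of one pair is multiplied by a size from the other, and the degrees [k] add up. *)
pose Q (x y : K) k := [/\ `|x| <= r ^+ k, `|y| <= r ^+ k &
  r * `|x - y| <= k%:R * r ^+ k * d].
have Q1 : Q 1 1 0.
  by split; rewrite ?normr1 ?expr0// subrr normr0 mulr0 !mul0r.
have QM (x y x' y' : K) k k' : Q x y k -> Q x' y' k' -> Q (x * x') (y * y') (k
  + k')%N.
  move=> [xk yk xyk] [xk' yk' xyk'].
  split; [by rewrite normrM exprD ler_pM|by rewrite normrM exprD ler_pM|].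
  have -> : x * x' - y * y' = x * (x' - y') + (x - y) * y'.
    by rewrite mulrBr mulrBl addrA subrK.
  rewrite (le_trans (ler_wpM2l r0 (ler_normD _ _)))// mulrDr !normrM.
  have -> : (k + k')%:R * r ^+ (k + k') * d =
    r ^+ k * (k'%:R * r ^+ k' * d) + (k%:R * r ^+ k * d) * r ^+ k'.
    by rewrite natrD exprD !mulrDl addrC -!mulrA !(mulrCA _ (r ^+ k)) (mulrC d).
  apply: lerD; first by rewrite mulrCA ler_pM// mulr_ge0.
  by rewrite mulrA ler_pM// mulr_ge0.
have QX i : Q (a i ^+ m i) (b i ^+ m i) (m i).
  elim: (m i) => [|k IHk]; first exact: Q1.
  rewrite !exprS -addn1 addnC; apply: QM => //.
  by split; rewrite ?expr1// mul1r ler_wpM2l.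
suff [] : Q (\prod_i a i ^+ m i) (\prod_i b i ^+ m i) (\sum_i m i)%N by [].
by elim/big_ind3 : _ => // *; exact: QM.
Qed.

(** Monomial by monomial from [ler_dist_prodX]. The factor [j] is the cost of differentiating a form
    of degree [j]. *)
Lemma ler_dist_meval j p x y (r : K) : p \is mpoly.ishomog1 j mpoly.mdeg ->
  `|x| <= r -> `|y| <= r ->
  r * `|ev p x - ev p y| <= coef_norm p * (j%:R * r ^+ j * `|x - y|).
Proof.
move=> pj xr yr; have r0 := le_trans (normr_ge0 _) xr.
rewrite !mpoly.mevalE -sumrB /coef_norm mulr_suml.
rewrite (le_trans (ler_wpM2l r0 (ler_norm_sum _ _ _)))// mulr_sumr.
rewrite !big_seq ler_sum// => m pm.
rewrite -mulrBr normrM mulrCA ler_wpM2l// -(sum_mnm_homog pj pm).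
apply: ler_dist_prodX => // i; first 2 last.
- by have := ler_coord_mx_norm (x - y) 0 i; rewrite !mxE.
- by rewrite (le_trans _ xr)// ler_coord_mx_norm.
- by rewrite (le_trans _ yr)// ler_coord_mx_norm.
Qed.

Context {T : Type} {F : set_system T} {FF : Filter F}.

Lemma cvg_meval p (v : T -> 'rV[K]_n) u : v k @[k --> F] --> u ->
  ev p (v k) @[k --> F] --> ev p u.
Proof.
move=> vu; under eq_fun do rewrite mpoly.mevalE.
rewrite mpoly.mevalE; apply: cvg_big => [|m _]; first exact: add_continuous.
apply: cvgM; first exact: cvg_cst.
apply: cvg_big => [|i _]; first exact: mul_continuous.
by apply: cvg_exprn; exact: cvg_coord.
Qed.

(** The derivative of [p] at [u] in the direction [v], spelled as the sum that occurs in [T2a]. *)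
Definition mgrad p u v : K := \sum_i mpoly.meval (u 0) (mpoly.mderiv i p) * v
  0 i.

Variables (t : T -> K) (z : T -> 'rV[K]_n) (u z0 : 'rV[K]_n).
Hypotheses (t0 : t k @[k --> F] --> (0 : K)) (tN0 : \forall k \near F, t k != 0)
  (zz0 : z k @[k --> F] --> z0).

Lemma cvg_add_scale : u + t k *: z k @[k --> F] --> u.
Proof.
have := cvgD (cvg_cst u) (cvgZ t0 zz0).
by rewrite scale0r addr0; apply.
Qed.

(** Differentiability along a direction [z k] that itself moves. The polynomials with this property
    contain the constants and the variables and are closed under sums and products. *)
Lemma cvg_meval_quotient p :
  (t k)^-1 * (ev p (u + t k *: z k) - ev p u) @[k --> F] --> mgrad p u z0.
Proof.
pose D p := (t k)^-1 * (ev p (u + t k *: z k) - ev p u) @[k --> F] --> mgrad p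
  u z0.
have D0 c : D (mpoly.mpolyC n c).
  rewrite /D /mgrad; under eq_fun do rewrite !mpoly.mevalC subrr mulr0.
  rewrite big1; first exact: cvg_cst.
  by move=> i _; rewrite mpoly.mderivC mpoly.meval0 mul0r.
have DD q q' : D q -> D q' -> D (q + q').
  move=> Dq Dq'; rewrite /D /mgrad.
  under eq_fun do rewrite !mpoly.mevalD opprD addrACA mulrDr.
  under eq_bigr do rewrite mpoly.mderivD mpoly.mevalD mulrDl.
  by rewrite big_split; exact: cvgD.
(* Leibniz rule: the quotient of a product splits with [q'] evaluated at the moving point, where
   continuity gives the limit [ev q' u]. *)
have DM q q' : D q -> D q' -> D (q * q').
  move=> Dq Dq'; rewrite /D /mgrad.
  under eq_fun do rewrite !mpoly.mevalM.
  have -> : \sum_i ev (mpoly.mderiv i (q * q')) u * z0 0 i =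
      mgrad q u z0 * ev q' u + ev q u * mgrad q' u z0.
    rewrite /mgrad mulr_suml mulr_sumr -big_split; apply: eq_bigr => i _ /=.
    by rewrite mpoly.mderivM mpoly.mevalD !mpoly.mevalM mulrDl mulrAC mulrA.
  have -> : (fun k => (t k)^-1 * (ev q (u + t k *: z k) * ev q' (u + t k *: z
    k) -
      ev q u * ev q' u)) = (fun k => ((t k)^-1 * (ev q (u + t k *: z k) - ev q
        u)) *
      ev q' (u + t k *: z k) + ev q u * ((t k)^-1 * (ev q' (u + t k *: z k) -
        ev q' u))).
    apply/funext => k; rewrite mulrCA -mulrA -mulrDr; congr (_ * _).
    by rewrite mulrBr mulrBl addrA subrK.
  apply: cvgD; apply: cvgM => //; last exact: cvg_cst.
  by apply: cvg_meval; exact: cvg_add_scale.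
(* For a variable the quotient equals the coordinate [z k 0 i] as soon as [t k] is nonzero. *)
have DX i : D (mpoly.mpolyX K (mpoly.mnm1 i)).
  rewrite /D; have -> : mgrad (mpoly.mpolyX K (mpoly.mnm1 i)) u z0 = z0 0 i.
    rewrite /mgrad (bigD1 i)//= big1 ?addr0 => [|j ji].
      rewrite mpoly.mderivX mpoly.mnm1E eqxx scale1r.
      have -> : mpoly.mnm_sub (mpoly.mnm1 i) (mpoly.mnm1 i) = mpoly.mnm0.
        by apply/mpoly.mnmP => j; rewrite mpoly.mnmBE subnn mpoly.mnm0E.
      by rewrite mpoly.mpolyX0 mpoly.meval1 mul1r.
    rewrite mpoly.mderivX mpoly.mnm1E eq_sym (negbTE ji).
    by rewrite scale0r mpoly.meval0 mul0r.
  apply: (cvg_trans (near_eq_cvg _) (cvg_coord (i := i) zz0)); near=> k.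
  rewrite !mpoly.mevalXU !mxE (addrC (u 0 i)) addrK mulKf//.
  by near: k.
have DX1 m : D (mpoly.mpolyX K m).
  rewrite mpoly.mpolyXE_id; elim/big_ind : _ => // [|i _]; first exact: (D0 1).
  elim: (m _) => [|k IHk]; first exact: (D0 1).
  by rewrite exprS; apply: DM.
elim/mpoly.mpolyind: p => [|c m p _ _ Dp]; first by rewrite -(mpoly.mpolyC0);
  apply: D0.
by apply: DD => //; rewrite -mpoly.mul_mpolyC; apply: DM.
Unshelve. all: by end_near. Qed.

End HomogeneousPolynomials.

(** * Taylor estimates for analytic functions *)

Section PowerSeries.
Context {K : numFieldType} {n : nat}.
Local Notation ev p v := (mpoly.meval (v 0) p).
Implicit Types (f : 'rV[K]_n -> K) (a u v x y : 'rV[K]_n).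
Implicit Types (P : nat -> mpolynomial K n).

(** The polydisc becomes a ball of the maximum norm, and convergence of the majorant series becomes
    a single bound [M] on all its blocks, the form in which the estimates below use it. *)
Lemma power_series_expansion_norm f a P : power_series_expansion f a P ->
  exists r M : K, [/\ 0 < r, 0 < M,
    cvgn (series (fun j => coef_norm (P j) * r ^+ j)),
    forall k l, \sum_(k <= j < l) coef_norm (P j) * r ^+ j <= M &
    forall x, `|x - a| < r ->
      series (fun j => ev (P j) (x - a)) @ \oo --> f x].
Proof.
move=> [_ [r [r0 cvP fP]]].
have cvS : cvgn (series (fun j => coef_norm (P j) * r ^+ j)).
  have -> // : (fun j => coef_norm (P j) * r ^+ j) = (fun j =>
      \sum_(m <- mpoly.msupp (P j)) `|mpoly.mcoeff m (P j)| * r ^+ j).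
  by apply/funext => j; rewrite /coef_norm mulr_suml.
have [M M0 SM] := pinfty_ex_gt0 (cvg_seq_bounded cvS).
have S0 j : 0 <= coef_norm (P j) * r ^+ j.
  by rewrite mulr_ge0 ?coef_norm_ge0// exprn_ge0// ltW.
exists r, M; split=> // [k l|x xar].
  have [kl|/ltnW lk] := leqP k l; last by rewrite big_geq// ltW.
  rewrite (le_trans _ (SM l I))// ger0_norm ?sumr_ge0//.
  by rewrite /series/= (big_cat_nat (leq0n k) kl)//= lerDr sumr_ge0.
apply: fP => i; apply: le_lt_trans xar.
by have := ler_coord_mx_norm (x - a) 0 i; rewrite !mxE.
Qed.

(** With [d = |x - a| / r < 1], a term of degree [j >= N] is at most
    [coef_norm (P j) * r ^+ j * d ^+ N]. Hence every block starting at [N] is at most [M * d ^+ N],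
    and so is the limit. *)
Lemma taylor_remainder f a P : power_series_expansion f a P ->
  exists r M : K, [/\ 0 < r, 0 < M & forall N x, `|x - a| < r ->
    `|f x - \sum_(0 <= j < N) ev (P j) (x - a)| <= M * (`|x - a| / r) ^+ N].
Proof.
move=> fP; have [homP _] := fP.
have [r [M [r0 M0 _ SM fr]]] := power_series_expansion_norm fP.
exists r, M; split=> // N x xr.
apply: (cvg_norm_subr_le (fr x xr)).
near=> k; have Nk : (N <= k)%N by near: k; exact: nbhs_infty_ge.
rewrite /series/= (big_cat_nat (leq0n N) Nk)//= addrAC subrr add0r.
rewrite (le_trans (ler_norm_sum _ _ _))//.
have d0 : 0 <= `|x - a| / r by rewrite divr_ge0// ltW.
apply: (le_trans _ (ler_wpM2r (exprn_ge0 N d0) (SM N k))).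
rewrite mulr_suml !big_nat ler_sum// => j /andP[Nj _].
rewrite (le_trans (ler_norm_meval (homP j) (lexx _)))//.
rewrite -mulrA ler_wpM2l ?coef_norm_ge0//.
rewrite -{1}(divfK (lt0r_neq0 r0) `|x - a|) exprMn mulrC.
apply: ler_wpM2l; first by rewrite exprn_ge0// ltW.
by apply: ler_wiXn2l => //; rewrite ler_pdivrMr// mul1r ltW.
Unshelve. all: by end_near. Qed.

(** Halving the radius absorbs the factor [j] of [ler_dist_meval]: [j (r / 2)^j <= r^j] since
    [j < 2^j]. The factor [r / 2] on the left there becomes the denominator of the constant. *)
Lemma analytic_at_lipschitz f a : analytic_at f a ->
  exists r C : K, [/\ 0 < r, 0 < C & forall x y, `|x - a| < r -> `|y - a| < r ->
    `|f x - f y| <= C * `|x - y|].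
Proof.
move=> [P fP]; have [homP _] := fP.
have [r [M [r0 M0 _ SM fr]]] := power_series_expansion_norm fP.
have r20 : 0 < r / 2 by rewrite divr_gt0.
have r2r : r / 2 <= r by rewrite ler_pdivrMr// ler_peMr ?(ltW r0)// ler1n.
exists (r / 2), (M / (r / 2)); split=> // [|x y xr yr]; first
  by rewrite divr_gt0.
have frB := cvgB (fr x (lt_le_trans xr r2r)) (fr y (lt_le_trans yr r2r)).
rewrite -[f x - f y]subr0.
apply: (cvg_norm_subr_le (frB _)).
near=> k; rewrite subr0 [X in `|X|](_ : _ =
    \sum_(0 <= j < k) (ev (P j) (x - a) - ev (P j) (y - a)));
      last exact/esym/sumrB.
rewrite -(ler_pM2l r20).
rewrite mulrA mulrCA divff ?lt0r_neq0// mulr1.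
rewrite (le_trans (ler_wpM2l (ltW r20) (ler_norm_sum _ _ _)))// mulr_sumr.
apply: (le_trans _ (ler_wpM2r (normr_ge0 _) (SM 0 k))).
rewrite mulr_suml ler_sum// => j _.
rewrite (le_trans (ler_dist_meval (homP j) (ltW xr) (ltW yr)))//.
rewrite opprB addrA subrK -!mulrA ler_wpM2l ?coef_norm_ge0// mulrA.
rewrite ler_wpM2r// expr_div_n mulrCA ger_pMr ?exprn_gt0//.
by rewrite ler_pdivrMr ?exprn_gt0// mul1r -natrX ler_nat ltnW// ltn_expl.
Unshelve. all: by end_near. Qed.

(** By homogeneity the form of degree [j] contributes [t^j] times its value at [v k]. After division
    by [t^m], degree [m] gives the limit and the remainder of order [m + 1] is [O(t)]. *)
Lemma cvg_taylor_quotient {T : Type} {F : set_system T} {FF : Filter F}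
    f P (t : T -> K) (v : T -> 'rV[K]_n) u m :
  power_series_expansion f 0 P ->
  t k @[k --> F] --> (0 : K) -> (\forall k \near F, t k != 0) ->
  v k @[k --> F] --> u ->
  (t k ^+ m)^-1 * (f (t k *: v k) - \sum_(0 <= j < m) t k ^+ j * ev (P j) (v k))
    @[k --> F] --> ev (P m) u.
Proof.
move=> fP t0 tN0 vu; have [homP _] := fP.
have [r [M [r0 M0 fr]]] := taylor_remainder fP.
have -> : (fun k => (t k ^+ m)^-1 *
    (f (t k *: v k) - \sum_(0 <= j < m) t k ^+ j * ev (P j) (v k))) =
  (fun k => (t k ^+ m)^-1 * (t k ^+ m * ev (P m) (v k)) + (t k ^+ m)^-1 *
    (f (t k *: v k) - \sum_(0 <= j < m.+1) t k ^+ j * ev (P j) (v k))).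
  by apply/funext => k; rewrite -mulrDr big_nat_recr//=; congr (_ * _); ring.
rewrite -[ev (P m) u]addr0; apply: cvgD.
  apply: (cvg_trans (near_eq_cvg _) (cvg_meval (p := P m) vu)); near=> k.
  by rewrite mulKf// expf_neq0//; near: k.
have tv0 : t k *: v k @[k --> F] --> (0 : 'rV[K]_n).
  by have := cvgZ t0 vu; rewrite scale0r; apply.
apply: (@cvg0_dominated _ _ _ _ _ _
  (fun k => M / r ^+ m.+1 * (`|t k| * `|v k| ^+ m.+1))); last first.
  have := cvgM (cvg_cst (M / r ^+ m.+1))
    (cvgM (cvg_norm t0) (cvg_exprn (k := m.+1) (cvg_norm vu))).
  by rewrite normr0 mul0r mulr0; apply.
near=> k.
have tk : t k != 0 by near: k.
have tvr : `|t k *: v k - 0| < r.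
  by rewrite subr0; near: k; move/cvgr0Pnorm_lt : tv0; apply.
rewrite normrM normfV normrX ler_pdivrMl ?exprn_gt0 ?normr_gt0//.
have := fr m.+1 _ tvr; rewrite subr0.
rewrite (_ : \sum_(0 <= j < m.+1) ev (P j) (t k *: v k) =
   \sum_(0 <= j < m.+1) t k ^+ j * ev (P j) (v k)); last first.
  by apply: eq_bigr => j _; rewrite (meval_homogZ _ _ (homP j)).
move=> /le_trans; apply.
rewrite normrZ !exprMn exprVn (exprS _ m).
by rewrite le_eqVlt; apply/orP; left; apply/eqP; ring.
Unshelve. all: by end_near. Qed.

(** The form of degree [m] is now subtracted at the fixed [u] instead of the moving point. The
    difference is of order [t^(m+1)] and contributes the derivative of [P m] to the limit. *)
Lemma cvg_second_order_quotient {T : Type} {F : set_system T} {FF : Filter F}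
    f P (t : T -> K) (z : T -> 'rV[K]_n) (u z0 : 'rV[K]_n) m :
  power_series_expansion f 0 P ->
  t k @[k --> F] --> (0 : K) -> (\forall k \near F, t k != 0) ->
  z k @[k --> F] --> z0 ->
  (t k ^+ m.+1)^-1 * (f (t k *: (u + t k *: z k))
      - \sum_(0 <= j < m) t k ^+ j * ev (P j) (u + t k *: z k)
      - t k ^+ m * ev (P m) u)
    @[k --> F] --> mgrad (P m) u z0 + ev (P m.+1) u.
Proof.
move=> fP t0 tN0 zz0.
apply: (cvg_trans (near_eq_cvg _) (cvgD
  (cvg_meval_quotient (u := u) (p := P m) t0 tN0 zz0)
  (cvg_taylor_quotient (m := m.+1) fP t0 tN0
    (cvg_add_scale (u := u) t0 zz0)))).
near=> k.
have tk : t k != 0 by near: k.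
rewrite addrfctE big_nat_recr//= exprS invfM.
have tmk : t k ^+ m != 0 by rewrite expf_neq0.
by field; apply/andP.
Unshelve. all: by end_near. Qed.

End PowerSeries.

(** * Substituting a quadratic curve into a power series *)

Section QuadraticSubstitution.
Context {K : numFieldType}.

(** Cauchy's majorants, for polynomials: the relation survives products, so bounds on the factors
    bound a whole monomial. *)
Definition coef_dominated (p q : {poly K}) := forall k, `|p`_k| <= q`_k.

Lemma coef_dominatedM p q p' q' : coef_dominated p q -> coef_dominated p' q' ->
  coef_dominated (p * p') (q * q').
Proof.
move=> pq pq' k; rewrite !coefM (le_trans (ler_norm_sum _ _ _))// ler_sum// =>
  i _.
by rewrite normrM ler_pM.
Qed.

Lemma coef_dominated1 : coef_dominated 1 1.
Proof. by move=> k; rewrite coef1; case: eqP; rewrite ?normr1 ?normr0. Qed.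

Lemma coef_dominatedX p q k : coef_dominated p q ->
  coef_dominated (p ^+ k) (q ^+ k).
Proof.
move=> pq; elim: k => [|k IHk]; first exact: coef_dominated1.
by rewrite !exprS; exact: coef_dominatedM.
Qed.

Definition quadratic_majorant (B : K) : {poly K} := B *: ('X + 'X^2).

(** Since [X + X^2 = X (1 + X)], the power is a multiple of [X^j (1 + X)^j]. *)
Lemma coef_quadratic_majorantX (B : K) j k :
  (quadratic_majorant B ^+ j)`_k != 0 -> (j <= k <= j.*2)%N.
Proof.
rewrite /quadratic_majorant exprZn coefZ mulf_eq0 negb_or => /andP[_].
have -> : ('X + 'X^2 : {poly K}) = 'X * (1 + 'X) by rewrite mulrDr mulr1.
rewrite exprMn coefXnM; case: ltnP => [|jk]; first by rewrite eqxx.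
apply: contraNT; rewrite -ltnNge => jjk.
rewrite nth_default// (leq_trans (size_poly_exp_leq _ _))//.
have -> : size (1 + 'X : {poly K}) = 2%N by rewrite addrC -polyC1 size_XaddC.
by rewrite mul1n -addnn in jjk *; rewrite ltn_subRL.
Qed.

Context {n : nat}.
Local Notation ev p v := (mpoly.meval (v 0) p).
Implicit Types (p : mpolynomial K n) (b : 'rV[K]_n).

(** Kept as a univariate polynomial so that equal powers of the parameter can be collected from
    forms of different degrees. *)
Definition quadratic_subst b1 b2 p : {poly K} :=
  mpoly.mmap polyC (fun i => b1 0 i *: 'X + b2 0 i *: 'X^2) p.

Lemma horner_quadratic_subst b1 b2 p s :
  (quadratic_subst b1 b2 p).[s] = ev p (s *: b1 + s ^+ 2 *: b2).
Proof.
rewrite /quadratic_subst /mpoly.mmap mpoly.mevalE horner_sum.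
apply: eq_bigr => m _; rewrite hornerM hornerC horner_prod; congr (_ * _).
apply: eq_bigr => i _; rewrite horner_exp hornerD !hornerZ hornerX hornerXn
  !mxE.
by rewrite (mulrC s) (mulrC (s ^+ 2)).
Qed.

(** Each of the [j] factors of a monomial becomes a coordinate of [s b1 + s^2 b2], which
    [quadratic_majorant B] dominates. *)
Lemma coef_quadratic_subst b1 b2 (B : K) p j k : `|b1| <= B -> `|b2| <= B ->
  p \is mpoly.ishomog1 j mpoly.mdeg ->
  `|(quadratic_subst b1 b2 p)`_k| <=
    coef_norm p * (quadratic_majorant B ^+ j)`_k.
Proof.
move=> b1B b2B homp; rewrite /quadratic_subst /mpoly.mmap coef_sum.
rewrite (le_trans (ler_norm_sum _ _ _))// /coef_norm mulr_suml.
rewrite !big_seq ler_sum// => m pm; rewrite coefCM normrM ler_wpM2l//.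
move: k; rewrite -/(coef_dominated _ _) -(sum_mnm_homog homp pm) -prodrXr.
rewrite /mpoly.mmap1; elim/big_ind2 : _ => [|* |i _].
- exact: coef_dominated1.
- exact: coef_dominatedM.
apply: coef_dominatedX => k; rewrite /quadratic_majorant coefZ !coefD !coefZ
  coefX coefXn.
have bB (b : 'rV[K]_n) : `|b| <= B -> `|b 0 i| <= B.
  exact/le_trans/ler_coord_mx_norm.
have B0 : 0 <= B by exact: le_trans b1B.
by case: k => [|[|[|k]]] /=; 
  rewrite ?(mulr0, addr0, add0r, mulr1, normr0) ?bB.
Qed.

(* A form of degree [j] contributes only in degrees [j] to [2 j], so every
   coefficient of the composite is a finite sum and completeness of [K] is not
   needed; partial sums of order [N] differ only by forms of degree between
   [N / 2] and [N]. *)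
Lemma analytic_at_comp_quadratic (f : 'rV[K]_n -> K) a b1 b2 :
  analytic_at f a -> exists (c : nat -> K) (r : K), 0 < r /\
    forall s, `|s| < r -> series (fun k => c k * s ^+ k) @ \oo -->
      f (a + (s *: b1 + s ^+ 2 *: b2)).
Proof.
move=> [P fP]; have [homP _] := fP.
have [r [M [r0 M0 cvA SM fr]]] := power_series_expansion_norm fP.
pose B : K := `|b1| + `|b2| + 1.
have B0 : 0 < B by rewrite ltr_wpDl// addr_ge0.
have b1B : `|b1| <= B by rewrite /B -addrA lerDl addr_ge0.
have b2B : `|b2| <= B by rewrite /B addrAC lerDr addr_ge0.
(* Chosen so that [rho <= 1] and [2 B rho < r], whence [B (rho + rho^2) < r]: the majorant evaluated
   at [rho] stays inside the radius of convergence. *)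
pose rho : K := r / (r + 2 * B).
have rB0 : 0 < r + 2 * B by rewrite addr_gt0// mulr_gt0.
have rho0 : 0 < rho by rewrite divr_gt0.
have rhor : B * (rho + rho ^+ 2) < r.
  have rho1 : rho <= 1 by rewrite ler_pdivrMr// mul1r lerDl mulr_ge0// ltW.
  have : B * (rho + rho ^+ 2) <= 2 * B * rho.
    rewrite [2 * B]mulrC -mulrA ler_pM2l// mulr_natl mulr2n lerD2l.
    by rewrite expr2 ger_pMr.
  move=> /le_lt_trans; apply; rewrite mulrA ltr_pdivrMr// mulrC ltr_pM2l//.
  by rewrite ltrDr.
pose q j := quadratic_subst b1 b2 (P j).
pose A j := coef_norm (P j) * r ^+ j.
have A0 j : 0 <= A j by rewrite mulr_ge0 ?coef_norm_ge0// exprn_ge0// ltW.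
have q0 j k : ~~ (j <= k <= j.*2)%N -> (q j)`_k = 0.
  move=> jk; apply/eqP; rewrite -normr_le0.
  rewrite (le_trans (coef_quadratic_subst k b1B b2B (homP j)))//.
  by have [-> //|/coef_quadratic_majorantX] := eqVneq (quadratic_majorant B ^+
    j)`_k 0;
    rewrite ?mulr0// (negbTE jk).
have size_q j N : (j < N)%N -> (size (q j) <= N.*2)%N.
  move=> jN; apply/leq_sizeP => k Nk; apply: q0.
  by rewrite negb_and -!ltnNge (leq_trans _ Nk) ?orbT// ltn_double.
exists (fun k => \sum_(0 <= j < k.+1) (q j)`_k), rho; split=> // s srho.
(* Any window of the expansion of [q j] is bounded by its majorant at [rho], where the [j]-th power
   of [quadratic_majorant B] is at most [r ^+ j]. *)
have qA j N m : (j < N)%N ->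
    `|\sum_(m <= k < N.*2) (q j)`_k * s ^+ k| <= A j.
  move=> jN; rewrite (le_trans (ler_norm_sum _ _ _))//.
  have Tj : (quadratic_majorant B ^+ j).[rho] <= r ^+ j.
    rewrite horner_exp /quadratic_majorant hornerZ hornerD hornerX hornerXn.
    apply: lerXn2r; rewrite ?nnegrE; [|exact: ltW|exact: ltW].
    by apply: mulr_ge0; [|apply: addr_ge0; [|apply: exprn_ge0]]; exact: ltW.
  rewrite (le_trans _ (ler_wpM2l (coef_norm_ge0 _) Tj))//.
  have sT : (size (quadratic_majorant B ^+ j) <= N.*2)%N.
    apply/leq_sizeP => k Nk; apply/eqP; apply: contraTT Nk =>
      /coef_quadratic_majorantX.
    by case/andP => _ kj; rewrite -ltnNge (leq_ltn_trans kj)// ltn_double.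
  rewrite (horner_coef_wide _ sT) mulr_sumr -(big_mkord xpredT (fun k =>
    coef_norm (P j) * ((quadratic_majorant B ^+ j)`_k * rho ^+ k))).
  have T0 k : 0 <= coef_norm (P j) * ((quadratic_majorant B ^+ j)`_k * rho ^+
    k).
    rewrite mulrA; apply: mulr_ge0; last by rewrite exprn_ge0// ltW.
    exact: le_trans (normr_ge0 _) (coef_quadratic_subst k b1B b2B (homP j)).
  have : \sum_(m <= k < N.*2) `|(q j)`_k * s ^+ k| <= \sum_(m <= k < N.*2)
      coef_norm (P j) * ((quadratic_majorant B ^+ j)`_k * rho ^+ k).
    rewrite ler_sum// => k _; rewrite normrM normrX mulrA ler_pM ?exprn_ge0//.
      exact: coef_quadratic_subst.
    by rewrite lerXn2r ?nnegrE// ltW.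
  move=> /le_trans; apply.
  have [mN|/ltnW Nm] := leqP m N.*2.
    by rewrite [leRHS](big_cat_nat (leq0n m) mN)//= lerDr sumr_ge0.
  by rewrite [leLHS]big_geq// sumr_ge0.
have x_r : `|(a + (s *: b1 + s ^+ 2 *: b2)) - a| < r.
  rewrite addrC addKr (le_lt_trans _ rhor)// (le_trans (ler_normD _ _))//.
  rewrite !normrZ mulrDr; apply: lerD.
    by rewrite mulrC ler_pM// ltW.
  rewrite mulrC -expr2; apply: ler_pM; rewrite ?exprn_ge0//.
  by apply: lerXn2r; rewrite ?nnegrE// ltW.
have := fr _ x_r; set x := a + _; rewrite (_ : x - a = s *: b1 + s ^+ 2 *:
  b2); last first.
  by rewrite /x addrC addKr.
move=> fx.
pose Q N := series (fun k => (\sum_(0 <= j < k.+1) (q j)`_k) * s ^+ k) N -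
  series (fun j => ev (P j) (s *: b1 + s ^+ 2 *: b2)) N.
suff Q0 : Q N @[N --> \oo] --> (0 : K).
  apply: (cvg_trans (near_eq_cvg _) (_ : Q N + series (fun j =>
    ev (P j) (s *: b1 + s ^+ 2 *: b2)) N @[N --> \oo] --> f x)).
    by apply: nearW => N; rewrite /Q subrK.
  by rewrite -[f x]add0r; apply: cvgD.
(* Both partial sums contain the same powers [s ^+ k] with [k < N]; only the higher powers inside
   the forms of degree below [N] survive. *)
have QE N : Q N = - \sum_(0 <= j < N) \sum_(N <= k < N.*2) (q j)`_k * s ^+ k.
  rewrite /Q /series/=.
  have -> : \sum_(0 <= k < N) (\sum_(0 <= j < k.+1) (q j)`_k) * s ^+ k =
      \sum_(0 <= j < N) \sum_(0 <= k < N) (q j)`_k * s ^+ k.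
    rewrite exchange_big_nat/= [LHS]big_nat [RHS]big_nat;
      apply: eq_bigr => k /andP[_ kN].
    rewrite mulr_suml [RHS](big_cat_nat (leq0n k.+1) kN)//= [X in _ + X]big_nat.
    rewrite [X in _ + X]big1 ?addr0// => j /andP[kj _].
    by rewrite q0 ?mul0r// leqNgt kj.
  rewrite -sumrB -sumrN [LHS]big_nat [RHS]big_nat;
    apply: eq_bigr => j /andP[_ jN].
  rewrite -horner_quadratic_subst (horner_coef_wide _ (size_q _ _ jN)).
  rewrite -(big_mkord xpredT (fun k => (q j)`_k * s ^+ k)).
  have NN : (N <= N.*2)%N by rewrite -addnn leq_addr.
  by rewrite [X in _ - X](big_cat_nat (leq0n N) NN)//= opprD addrA subrr add0r.
(* A form of degree [j] reaches the power [N] only if [2 j >= N]. The error is thus at most a block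
   of the convergent series of [A] whose two ends both go to infinity. *)
apply: (@cvg0_dominated _ _ _ _ _ _ (fun N => series A N - series A (uphalf
  N))).
  apply: nearW => N; rewrite QE normrN.
  have hN : (uphalf N <= N)%N by rewrite leq_uphalf_double -addnn leq_addr.
  rewrite /series/= (big_cat_nat (leq0n _) hN)//= [leRHS](_ : _ =
    \sum_(uphalf N <= j < N) A j); last first.
    by rewrite (big_cat_nat (leq0n _) hN)//= addrAC subrr add0r.
  rewrite [X in X + _]big_nat big1 ?add0r => [|j /andP[_]]; last first.
    rewrite gtn_uphalf_double => jN; rewrite big_nat big1// => k /andP[Nk _].
    by rewrite q0 ?mul0r// negb_and -!ltnNge (leq_trans jN)// orbT.
  rewrite (le_trans (ler_norm_sum _ _ _))// !big_nat ler_sum// => j /andP[_ jN].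
  exact: qA.
move/cvg_ex : cvA => [l cvA]; rewrite -(subrr l); apply: cvgB => //.
apply: (cvg_comp uphalf (series A) _ cvA).
apply/cvgnyPge => N; near=> k.
rewrite geq_uphalf_double leqW//; near: k; exact: nbhs_infty_ge.
Unshelve. all: by end_near. Qed.

End QuadraticSubstitution.

(** * The embedding of the reals into the scalars *)

Section RealScalars.
Context {R : realType} {s : scalar_kind}.
Local Notation K := (scalars R s).
Local Notation "t %:K" := (@of_real R s t) (at level 2, format "t %:K").

Lemma of_real_is_zmod_morphism : zmod_morphism (@of_real R s).
Proof. by case: s => // a b; exact: (raddfB (real_complex R)). Qed.

Lemma of_real_is_monoid_morphism : monoid_morphism (@of_real R s).
Proof. by case: s; split=> // a b; exact: (rmorphM (real_complex R)). Qed.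

HB.instance Definition _ :=
  GRing.isZmodMorphism.Build R K (@of_real R s) of_real_is_zmod_morphism.
HB.instance Definition _ :=
  GRing.isMonoidMorphism.Build R K (@of_real R s) of_real_is_monoid_morphism.

Lemma norm_of_real (t : R) : `|t%:K| = `|t|%:K.
Proof.
by rewrite /of_real; case: s => //=; rewrite normc_def /= expr0n addr0
  sqrtr_sqr.
Qed.

Lemma ltr_of_real (t t' : R) : (t%:K < t'%:K) = (t < t').
Proof. by rewrite /of_real; case: s => //=; exact: ltcR. Qed.

Lemma of_real_gt0 (t : R) : (0 < t%:K) = (0 < t).
Proof. by rewrite -(rmorph0 (@of_real R s)) ltr_of_real. Qed.

(** Turns radii and tolerances in [K] into real ones. A positive complex number has zero imaginary
    part, so its real part serves. *)
Lemma ex_of_real_gt0 (x : K) : 0 < x -> exists2 e : R, 0 < e & e%:K <= x.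
Proof.
case: s x => [|] x x0; first by exists x => //=.
case: x x0 => a b; rewrite ltcE /= => /andP[/eqP b0 a0]; exists a => //.
by rewrite lecE /= b0 eqxx lexx.
Qed.

Context {T : Type} {F : set_system T} {FF : Filter F}.

Lemma cvg_of_real (f : T -> R) : f x @[x --> F] --> (0 : R) ->
  (f x)%:K @[x --> F] --> (0 : K).
Proof.
move=> f0; apply/cvgr0Pnorm_lt => e /ex_of_real_gt0[d d0 de].
move/cvgr0Pnorm_lt : f0 => /(_ d d0); apply: filterS => x fd.
by rewrite (lt_le_trans _ de)// norm_of_real ltr_of_real.
Qed.

End RealScalars.

(** * Constant terms, Lipschitz bounds and continuity of analytic maps *)

Section AnalyticMaps.
Context {K : numFieldType} {n : nat}.
Local Notation ev p v := (mpoly.meval (v 0) p).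
Implicit Types (f : 'rV[K]_n -> K) (phi : 'rV[K]_n -> 'rV[K]_n).
Implicit Types (a u v x y : 'rV[K]_n).

Lemma power_series_expansion_coef0 f a P v :
  power_series_expansion f a P -> ev (P 0%N) v = f a.
Proof.
move=> fP; have [homP _] := fP; have [r [M [r0 M0 fr]]] := taylor_remainder fP.
have : `|a - a| < r by rewrite subrr normr0.
move=> /(fr 1%N); rewrite subrr normr0 mul0r expr1 mulr0 normr_le0 subr_eq0.
(* Writing the centre as [0 *: v] and using [0 ^+ 0 = 1] shows that a form of degree zero takes the
   same value at every [v]. *)
move=> /eqP ->; rewrite big_nat1 -(scale0r v).
by rewrite (meval_homogZ _ _ (homP _)) expr0 mul1r.
Qed.

Lemma mgradZ p u v (c : K) : mgrad (n := n) p u (c *: v) = c * mgrad p u v.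
Proof.
by rewrite /mgrad mulr_sumr; apply: eq_bigr => i _; rewrite mxE mulrCA.
Qed.

Lemma analytic_map_lipschitz V phi a : analytic_map_on V phi -> V a ->
  exists (A : set 'rV[K]_n) (C : K), [/\ nbhs a A, 0 < C &
    forall x y, A x -> A y -> `|phi x - phi y| <= C * `|x - y|].
Proof.
move=> aphi Va.
have /choice[rC phiC] : forall i, exists rC : K * K, [/\ 0 < rC.1, 0 < rC.2 &
    forall x y, `|x - a| < rC.1 -> `|y - a| < rC.1 ->
      `|phi x 0 i - phi y 0 i| <= rC.2 * `|x - y|].
  by move=> i; have [r [C rC]] := analytic_at_lipschitz (aphi i a Va);
    exists (r, C).
(* The sum dominates the constant of every coordinate, and the added [1] keeps it positive even when
   [n] is zero. *)
exists [set x | forall i, `|x - a| < (rC i).1], (1 + \sum_i (rC i).2); split.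
- apply: (@filter_forall _ _ (fun i x => `|x - a| < (rC i).1) (nbhs a)
  (nbhs_filter a)) => i; have [r0 _ _] := phiC i.
  have /cvgrPdist_lt/(_ _ r0) := @cvg_id _ (nbhs a).
  by apply: filterS => x; rewrite distrC.
- by rewrite ltr_pwDl// sumr_ge0// => i _; have [_ /ltW] := phiC i.
move=> x y Ax Ay; apply: mx_norm_leP => [|j i].
  by rewrite mulr_ge0// addr_ge0// sumr_ge0// => i _; have [_ /ltW] := phiC i.
rewrite ord1 !mxE; have [_ C0] := phiC i; move/(_ x y (Ax i) (Ay i)) =>
  /le_trans; apply.
rewrite ler_wpM2r// (bigD1 i)//= addrCA lerDl addr_ge0// sumr_ge0// => k _.
by have [_ /ltW] := phiC k.
Qed.

Lemma analytic_map_continuous V phi a : analytic_map_on V phi -> V a ->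
  phi x @[x --> a] --> phi a.
Proof.
move=> aphi Va; have [A [C [aA C0 phiC]]] := analytic_map_lipschitz aphi Va.
have FF : Filter (nbhs a) := nbhs_filter a.
apply/cvgrPdist_lt => e e0.
have eC0 : 0 < e / C by rewrite divr_gt0.
have /cvgrPdist_lt/(_ _ eC0) := @cvg_id _ (nbhs a).
have Aa := nbhs_singleton aA.
move: aA; apply: filterS2 => x Ax xa.
rewrite (le_lt_trans (phiC _ _ Aa Ax))//.
by rewrite mulrC -ltr_pdivlMr.
Qed.

End AnalyticMaps.

(** * The two second-order tangent sets and the tangent cone *)

Section TangentSets.
Context {R : realType} {s : scalar_kind} {n : nat}.
Local Notation K := (scalars R s).
Local Notation "t %:K" := (@of_real R s t) (at level 2, format "t %:K").
Local Notation ev p v := (mpoly.meval (v 0) p).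
Implicit Types (X : set 'rV[K]_n) (f : 'rV[K]_n -> K) (u v w : 'rV[K]_n).

Lemma near_of_real_neq0 : \forall t \near (0 : R)^'+, t%:K != 0.
Proof.
near=> t; rewrite fmorph_eq0 gt_eqF//; near: t; exact: nbhs_right_gt.
Unshelve. all: by end_near. Qed.

Lemma cvg_of_real_at_right : t%:K @[t --> (0 : R)^'+] --> (0 : K).
Proof. by apply: cvg_of_real; apply: cvg_at_right_filter; exact: cvg_id. Qed.

(** Factoring out [t] gives the shape [t (u + t z)] with [z = w / 2] that the quotient lemmas
    expect. *)
Lemma second_order_point (t : R) u w :
  t%:K *: u + (2^-1 * t ^+ 2)%:K *: w = t%:K *: (u + t%:K *: (2^-1 *: w)).
Proof.
rewrite scalerDr !scalerA rmorphM rmorphXn fmorphV rmorph_nat;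
  congr (_ + _ *: _).
by rewrite mulrC expr2.
Qed.

(** A germ of order [m] vanishes along the points [t_k u + t_k^2 w_k / 2]. Dividing by [t_k^m] gives
    [P m] zero at [u]; dividing then by the next power gives the equation of [T2a]. *)
Lemma T2_sub_T2a X u : T2 X u `<=` T2a X u.
Proof.
move=> w [t [w_ [t0 _ tcvg wcvg Xt]]] f [_ fX] _ Pm Pm1.
move=> [P [m [fP PmN0 Pj0 -> ->]]].
pose z k := 2^-1 *: w_ k.
have zcvg : z k @[k --> \oo] --> 2^-1 *: w by apply: cvgZr.
have taucvg : (t k)%:K @[k --> \oo] --> (0 : K) by exact: cvg_of_real.
have tauN0 : \forall k \near \oo, (t k)%:K != 0.
  by apply: nearW => k; rewrite fmorph_eq0 gt_eqF.
have vcvg : u + (t k)%:K *: z k @[k --> \oo] --> u.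
  exact: cvg_add_scale taucvg zcvg.
have f0 : \forall k \near \oo, f ((t k)%:K *: (u + (t k)%:K *: z k)) = 0.
  have tv : (t k)%:K *: (u + (t k)%:K *: z k) @[k --> \oo] --> (0 : 'rV[K]_n).
    by rewrite -(scale0r u); exact: cvgZ taucvg vcvg.
  have Xf : \forall k \near \oo, X ((t k)%:K *: (u + (t k)%:K *: z k)) ->
      f ((t k)%:K *: (u + (t k)%:K *: z k)) = 0 := tv _ fX.
  apply: filterS Xf => k; apply.
  by rewrite -second_order_point; exact: Xt.
have sum0 (tau : K) (v : 'rV[K]_n) : \sum_(0 <= j < m) tau ^+ j * ev (P j) v =
  0.
  by rewrite big_nat big1// => j /andP[_ /Pj0 ->]; rewrite mpoly.meval0 mulr0.
have Pmu : ev (P m) u = 0.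
  apply/eqP; rewrite -normr_le0 -[ev _ _]subr0.
  apply: (cvg_norm_subr_le (cvg_taylor_quotient (m := m) fP taucvg tauN0 vcvg)).
  by apply: filterS f0 => k ->; rewrite sum0 subrr mulr0 subrr normr0.
rewrite -mgradZ; apply/eqP; rewrite -normr_le0 -[_ + _]subr0.
apply: (cvg_norm_subr_le
  (cvg_second_order_quotient (u := u) (m := m) fP taucvg tauN0 zcvg)).
by apply: filterS f0 => k ->; rewrite sum0 Pmu mulr0 !subrr mulr0 subrr normr0.
Qed.

Lemma second_order_realizable_T2a_sub X u :
  second_order_realizable X u -> T2a X u `<=` T2 X u.
Proof.
move=> realX w /realX[e [g [e0 _ Xg gcvg]]].
(* The shift by two keeps [t 0] strictly below [e], inside the domain of the curve. *)
pose t k : R := e / k.+2%:R.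
have t0 k : 0 < t k by rewrite divr_gt0.
have te k : t k < e by rewrite ltr_pdivrMr// ltr_pMr// ltr1n.
have tcvg : t k @[k --> \oo] --> (0 : R).
  rewrite -(mulr0 e); apply: cvgMr.
  by rewrite (cvg_shiftS (fun k => k.+1%:R^-1 : R)); exact: cvg_harmonic.
(* [w_k] is solved from [g t_k = t_k u + t_k^2 w_k / 2], so membership in [X] is immediate and
   convergence to [w] is the [o(t^2)] condition. *)
exists t, (fun k => ((t k ^+ 2 / 2)^-1)%:K *: (g (t k) - (t k)%:K *: u)).
have t2 k : (2^-1 * t k ^+ 2)%:K * ((t k ^+ 2 / 2)^-1)%:K = 1.
  by rewrite -rmorphM [t k ^+ 2 / 2]mulrC divff ?rmorph1// mulf_neq0
    ?expf_neq0 ?gt_eqF.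
split=> //.
- by move=> i j ij; rewrite ler_pM2l// lef_pV2 ?posrE// ler_nat.
- have tr : t k @[k --> \oo] --> (0 : R)^'+.
    move=> A [d /= d0 dA].
    move/cvgrPdist_lt : tcvg => /(_ d d0); apply: filterS => k kd.
    exact: dA.
  apply: cvg_zero.
  apply: (cvg_trans (near_eq_cvg _) (_ : (2%:R : K) *: ((t k ^- 2)%:K *: (g (t
    k) -
    ((t k)%:K *: u + (2^-1 * t k ^+ 2)%:K *: w))) @[k --> \oo] --> (0 :
      'rV[K]_n))).
    apply: nearW => k; rewrite scalerA opprD addrA scalerBr scalerA.
    have -> : 2 * (t k ^- 2)%:K = ((t k ^+ 2 / 2)^-1)%:K.
      by rewrite invf_div rmorphM rmorph_nat.
    by rewrite [_ * (2^-1 * _)%:K]mulrC t2 scale1r.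
  rewrite -(scaler0 _ 2%:R); apply: cvgZr.
  exact: (cvg_comp t _ tr gcvg).
- move=> k; rewrite scalerA t2 scale1r addrC subrK; apply: Xg.
  by rewrite t0 te.
Qed.

(** Write [x_k = sigma_k v_k] with [v_k = t_k x_k] tending to [u] and [sigma_k = 1 / t_k]. The
    first-order quotient of [f] along these points is zero and tends to the linear form at [u]. *)
Lemma tangent_cone_linear_form X f P u : X 0 -> vanishing_germ X f ->
  power_series_expansion f 0 P -> tangent_cone_0 X u -> u != 0 ->
  ev (P 1%N) u = 0.
Proof.
move=> X0 [_ fX] fP [x [t [Xx t0 xcvg vcvg]]] uN0.
pose sigma k := ((t k)%:K)^-1.
have tN0 k : (t k)%:K != 0 by rewrite fmorph_eq0 gt_eqF.
have sN0 k : sigma k != 0 by rewrite invr_neq0.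
have sx k : sigma k *: ((t k)%:K *: x k) = x k
  by rewrite scalerA mulVf ?scale1r.
have u0 : 0 < `|u| / 2 by rewrite divr_gt0 ?normr_gt0.
have scvg : sigma k @[k --> \oo] --> (0 : K).
  (* Eventually [|v_k| >= |u| / 2 > 0], so [sigma_k] is at most a constant times [|x_k|]; this is
     where [u] must be nonzero. *)
  apply: (cvg0_dominated (g := fun k => (`|u| / 2)^-1 * `|x k|)); last first.
    by have := cvgMr (a := (`|u| / 2)^-1) (cvg_norm xcvg);
      rewrite normr0 mulr0; apply.
  have : \forall k \near \oo, `|u - (t k)%:K *: x k| <= `|u| / 2.
    by move/cvgrPdist_le : vcvg; apply.
  apply: filterS => k uk; rewrite mulrC ler_pdivlMr// -[x k in leRHS]sx normrZ
    ler_wpM2l//.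
  have := ler_normD (u - (t k)%:K *: x k) ((t k)%:K *: x k); rewrite subrK.
  rewrite -lerBlDl; apply: le_trans.
  by rewrite lerBrDl [leRHS]splitr lerD2r.
have f00 : f 0 = 0 by exact: nbhs_singleton fX X0.
apply/eqP; rewrite -normr_le0 -[ev _ _]subr0.
apply: (cvg_norm_subr_le
  (cvg_taylor_quotient (m := 1) fP scvg (nearW _ sN0) vcvg)).
have Xf : \forall k \near \oo, X (x k) -> f (x k) = 0 := xcvg _ fX.
apply: filterS Xf => k; have [Xk _] := Xx k => /(_ Xk) fk.
rewrite sx fk big_nat1 (power_series_expansion_coef0 _ fP) f00.
by rewrite mulr0 subrr mulr0 subrr normr0.
Qed.

End TangentSets.

(** Upgrades the vanishing value to a vanishing polynomial, as [initial_forms] demands of the forms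
    below the order. *)
Lemma power_series_expansion_coef0_eq0 (K : numFieldType) n
    (f : 'rV[K]_n -> K) a P :
  power_series_expansion f a P -> f a = 0 -> P 0%N = 0.
Proof.
move=> fP fa0; have [/(_ 0%N) hom0 _] := fP.
have P0C : P 0%N = mpoly.mpolyC n (mpoly.mcoeff mpoly.mnm0 (P 0%N)).
  apply/mpoly.mpolyP => m; rewrite mpoly.mcoeffC.
  have [->|m0] := eqVneq m mpoly.mnm0; first by rewrite mulr1.
  rewrite (mpoly.dhomog_nemf_coeff hom0) ?mpoly.mdeg_eq0//.
  by rewrite mulr0.
have := power_series_expansion_coef0 0 fP; rewrite fa0 P0C mpoly.mevalC => ->.
exact: mpoly.mpolyC0.
Qed.

(** * Realizing curves through a chart at a smooth point *)

Section SmoothPoint.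
Context {R : realType} {s : scalar_kind} {n : nat}.
Local Notation K := (scalars R s).
Local Notation "t %:K" := (@of_real R s t) (at level 2, format "t %:K").
Local Notation ev p v := (mpoly.meval (v 0) p).
Implicit Types (X U : set 'rV[K]_n) (f : 'rV[K]_n -> K) (u v w : 'rV[K]_n).

Variables (V W : set 'rV[K]_n) (phi psi : 'rV[K]_n -> 'rV[K]_n).
Hypotheses (oV : open_nbhs (0 : 'rV[K]_n) V) (oW : open W).
Hypotheses (anphi : analytic_map_on V phi) (anpsi : analytic_map_on W psi).
Hypotheses (phiK : forall x, V x -> W (phi x) /\ psi (phi x) = x)
  (psiK : forall y, W y -> V (psi y) /\ phi (psi y) = y).

Let V0 : V 0. Proof. by case: oV. Qed.
Let Wphi0 : W (phi 0). Proof. by have [] := phiK V0. Qed.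
Let psiphi0 : psi (phi 0) = 0. Proof. by have [] := phiK V0. Qed.
Let nbhsW : nbhs (phi 0) W. Proof. exact: open_nbhs_nbhs. Qed.

Lemma cvg_quadratic_curve (b0 b1 b2 : 'rV[K]_n) :
  b0 + (t%:K *: b1 + t%:K ^+ 2 *: b2) @[t --> (0 : R)^'+] --> b0.
Proof.
have t0 := @cvg_of_real_at_right R s.
have t20 : t%:K ^+ 2 @[t --> (0 : R)^'+] --> (0 : K) ^+ 2 by exact: cvg_exprn.
rewrite expr0n /= in t20.
have tb1 : t%:K *: b1 @[t --> (0 : R)^'+] --> (0 : 'rV[K]_n).
  by rewrite -(scale0r b1); exact: cvgZ t0 (cvg_cst _).
have tb2 : t%:K ^+ 2 *: b2 @[t --> (0 : R)^'+] --> (0 : 'rV[K]_n).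
  by rewrite -(scale0r b2); exact: cvgZ t20 (cvg_cst _).
rewrite -[X in _ --> X](addr0 b0) -(addr0 (0 : 'rV[K]_n)).
by apply: cvgD; [exact: cvg_cst|exact: cvgD].
Qed.

(** The [i]-th axis pulled back by [psi] is a test path: [phi] grows exactly linearly along it in
    coordinate [i], while the path is [O(t)] because [psi] is Lipschitz. *)
Lemma near_chart_axis i : exists C : K, 0 < C /\
  \forall t \near (0 : R)^'+, let x := psi (phi 0 + t%:K *: delta_mx 0 i) in
    phi x 0 i = phi 0 0 i + t%:K /\ `|x| <= C * t%:K.
Proof.
have [A [C [A0 C0 psiC]]] := analytic_map_lipschitz anpsi Wphi0.
have ccvg := @cvg_quadratic_curve (phi 0) (delta_mx 0 i) 0.
exists (C * `|delta_mx 0 i : 'rV[K]_n| + 1); split; first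
  by rewrite ltr_wpDl// mulr_ge0// ltW.
near=> t; move=> /=; set x := psi _.
have cE : phi 0 + (t%:K *: delta_mx 0 i + t%:K ^+ 2 *: 0) = phi 0 + t%:K *:
  delta_mx 0 i.
  by rewrite scaler0 addr0.
have Wc : W (phi 0 + t%:K *: delta_mx 0 i).
  by rewrite -cE; near: t; exact: ccvg nbhsW.
have Ac : A (phi 0 + t%:K *: delta_mx 0 i).
  by rewrite -cE; near: t; exact: ccvg A0.
have t0 : 0 < t by near: t; exact: nbhs_right_gt.
split; first by have [_ ->] := psiK Wc; rewrite !mxE !eqxx mulr1.
rewrite -[x]subr0 -psiphi0 (le_trans (psiC _ _ Ac (nbhs_singleton A0)))//.
rewrite [phi 0 + _]addrC addrK normrZ gtr0_norm ?of_real_gt0// mulrCA mulrDl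
  mul1r.
by rewrite mulrC lerDl ltW// of_real_gt0.
Unshelve. all: by end_near. Qed.

(** Without a linear part the coordinate would vary by [O(|x|^2)], hence by at most [D t^2] along
    the pulled-back axis, where it varies by exactly [t]. This is impossible for small [t]. *)
Lemma chart_linear_form_neq0 i P :
  power_series_expansion (fun x => phi x 0 i) 0 P -> P 1%N != 0.
Proof.
move=> fP; apply/eqP => P10.
have [C [C0 near_x]] := near_chart_axis i.
have [r [M [r0 M0 phir]]] := taylor_remainder fP.
pose D : K := M * (C / r) ^+ 2.
have D0 : 0 < D by rewrite mulr_gt0// exprn_gt0// divr_gt0.
have t0cvg := @cvg_of_real_at_right R s.
have small (e : K) : 0 < e -> \forall t \near (0 : R)^'+, t%:K < e.
  move=> e0; near=> t'.
  have t'0 : 0 < t'%:K :> K by rewrite of_real_gt0; near: t';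
    exact: nbhs_right_gt.
  by rewrite -(gtr0_norm t'0); near: t'; move/cvgr0Pnorm_lt : t0cvg; apply.
have : \forall t \near (0 : R)^'+, False; last by move/filter_ex => [].
near=> t.
have t0 : 0 < t%:K :> K by rewrite of_real_gt0; near: t; exact: nbhs_right_gt.
have : (let x := psi (phi 0 + t%:K *: delta_mx 0 i) in
    phi x 0 i = phi 0 0 i + t%:K /\ `|x| <= C * t%:K) by near: t.
set x := psi _ => /= -[phix xt].
have xr : `|x - 0| < r.
  rewrite subr0 (le_lt_trans xt)// mulrC -ltr_pdivlMr//; near: t.
  by apply: small; rewrite divr_gt0.
have := phir 2%N x xr.
rewrite big_nat_recr//= big_nat1 P10 mpoly.meval0 addr0
  (power_series_expansion_coef0 _ fP).
rewrite phix addrAC subrr add0r gtr0_norm// subr0 => tle.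
suff : t%:K <= D * t%:K * t%:K :> K.
  have Dt : D * t%:K < 1.
    by rewrite mulrC -ltr_pdivlMr//; near: t; apply: small; rewrite divr_gt0.
  by rewrite -{1}[t%:K]mul1r ler_pM2r// => /le_lt_trans/(_ Dt); rewrite ltxx.
have -> : D * t%:K * t%:K = M * (C * t%:K / r) ^+ 2 by rewrite /D; ring.
apply: (le_trans tle); rewrite ler_pM2l//.
apply: lerXn2r; rewrite ?nnegrE; last by rewrite ler_pM2r ?invr_gt0.
- by rewrite mulr_ge0// invr_ge0 ltW.
- by rewrite ltW// divr_gt0// mulr_gt0.
Unshelve. all: by end_near. Qed.

(** Along the pulled-back axis, which tends to the origin, the coordinate equals [t > 0]. This
    admits it as a test germ in [T2a]. *)
Lemma chart_nonzero_germ i : phi 0 0 i = 0 -> nonzero_germ (fun x => phi x 0 i).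
Proof.
move=> phi0 phiZ; have [C [C0 near_x]] := near_chart_axis i.
have ccvg := @cvg_quadratic_curve (phi 0) (delta_mx 0 i) 0.
have psicvg : psi y @[y --> phi 0] --> (0 : 'rV[K]_n).
  by have := analytic_map_continuous anpsi Wphi0; rewrite psiphi0; apply.
have phiZ' : \forall t \near (0 : R)^'+,
    phi (psi (phi 0 + (t%:K *: delta_mx 0 i + t%:K ^+ 2 *: 0))) 0 i = 0.
  exact: ccvg (psicvg _ phiZ).
have : \forall t \near (0 : R)^'+, False; last by move/filter_ex => [].
near=> t.
have t0 : 0 < t%:K :> K by rewrite of_real_gt0; near: t; exact: nbhs_right_gt.
have : phi (psi (phi 0 + (t%:K *: delta_mx 0 i + t%:K ^+ 2 *: 0))) 0 i = 0
  by near: t.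
rewrite scaler0 addr0.
have [-> _] : (let x := psi (phi 0 + t%:K *: delta_mx 0 i) in
    phi x 0 i = phi 0 0 i + t%:K /\ `|x| <= C * t%:K) by near: t.
by rewrite phi0 add0r => /eqP; rewrite gt_eqF.
Unshelve. all: by end_near. Qed.

Lemma smooth_second_order_realizable (d : nat) X U u :
  open_nbhs (0 : 'rV[K]_n) U -> X 0 ->
  phi @` ((X `&` U) `&` V) = coordinate_subspace d `&` W ->
  tangent_cone_0 X u -> u != 0 -> second_order_realizable X u.
Proof.
move=> oU X0 phiX ucone uN0 w wT2a.
have nbhsU : nbhs (0 : 'rV[K]_n) U by exact: open_nbhs_nbhs.
have nbhsV : nbhs (0 : 'rV[K]_n) V by exact: open_nbhs_nbhs.
have /choice[P phiP] : forall i, exists P, power_series_expansion (fun x =>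
  phi x 0 i) 0 P.
  by move=> i; exact: anphi.
have phi_coord x : X x -> U x -> V x -> coordinate_subspace d (phi x).
  move=> Xx Ux Vx; have : (phi @` ((X `&` U) `&` V)) (phi x) by exists x.
  by rewrite phiX => -[].
have U0 : U 0 by case: oU.
(* The coordinates normal to the subspace are the germs to which the equations of [T2a] are
   applied. *)
have germ (i : 'I_n) : (d <= i)%N -> vanishing_germ X (fun x => phi x 0 i).
  move=> di; split; first exact: anphi.
  move: nbhsU nbhsV; apply: filterS2 => x Ux Vx Xx.
  exact: phi_coord di.
have phi00 (i : 'I_n) : (d <= i)%N -> phi 0 0 i = 0 by exact: phi_coord.
(* Taylor coefficients of [phi (t u + t^2 w / 2)]: degree two collects the linear form at [w / 2],
   written through its gradient, and the quadratic form at [u]. *)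
pose y1 : 'rV[K]_n := \row_i ev (P i 1%N) u.
pose y2 : 'rV[K]_n := \row_i (mgrad (P i 1%N) u (2^-1 *: w) + ev (P i 2%N) u).
have y10 (i : 'I_n) : (d <= i)%N -> y1 0 i = 0.
  by move=> di; rewrite mxE; apply: (tangent_cone_linear_form X0 (germ i di)
    (phiP i)).
have y20 (i : 'I_n) : (d <= i)%N -> y2 0 i = 0.
  move=> di; rewrite mxE mgradZ.
  (* The order of the germ is exactly one, so its [T2a] equation involves the forms of degrees one
     and two and reads [y2 0 i = 0]. *)
  apply: (wT2a _ (germ i di) (chart_nonzero_germ (phi00 i di))).
  exists (P i), 1%N; split=> //; first exact: chart_linear_form_neq0.
  by move=> [|//] _; exact: power_series_expansion_coef0_eq0 (phiP i) (phi00 i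
    di).
pose c (t : K) := phi 0 + (t *: y1 + t ^+ 2 *: y2).
have c_coord t : coordinate_subspace d (c t).
  move=> i di; rewrite (_ : _ 0 i = phi 0 0 i + (t * y1 0 i + t ^+ 2 * y2 0 i)).
    by rewrite phi00// y10// y20// !mulr0 !addr0.
  by rewrite !mxE.
have ccvg : c t%:K @[t --> (0 : R)^'+] --> phi 0 by exact: cvg_quadratic_curve.
have [e /= e0 We] : \forall t \near (0 : R)^'+, W (c t%:K) by exact: ccvg nbhsW.
have Wc t : 0 < t < e -> W (c t%:K).
  move=> /andP[t0 te]; apply: We => //=.
  by rewrite sub0r normrN gtr0_norm.
exists e, (fun t => psi (c t%:K)); split=> //.
- move=> t0 t0e i.
  (* The quadratic curve is recentred at [t0]: its velocity there is [y1 + 2 t0 y2] and its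
     quadratic coefficient is unchanged. *)
  have [a [r [r0 ar]]] := analytic_at_comp_quadratic (y1 + (2 * t0%:K) *: y2) y2
    (anpsi i (Wc t0 t0e)).
  have [r' r'0 r'r] := ex_of_real_gt0 r0.
  exists a, r'; split=> // t tt0.
  have cE : c t%:K = c t0%:K + ((t - t0)%:K *: (y1 + (2 * t0%:K) *: y2) +
      (t - t0)%:K ^+ 2 *: y2).
    by apply/rowP => j; rewrite !mxE rmorphB; ring.
  rewrite cE; apply: ar.
  by rewrite (lt_le_trans _ r'r)// norm_of_real ltr_of_real.
- move=> t te; have : (phi @` ((X `&` U) `&` V)) (c t%:K).
    by rewrite phiX; split; [exact: c_coord|exact: Wc].
  by move=> [x [[Xx Ux] Vx] <-]; have [_ ->] := phiK Vx.
(* With [x t] the prescribed second-order point, the error is [psi (c t) - psi (phi (x t))]; the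
   Lipschitz bound reduces it to showing [phi (x t) - c t = o(t^2)]. *)
have [A [C [A0 C0 psiC]]] := analytic_map_lipschitz anpsi Wphi0.
pose x (t : R) := t%:K *: (u + t%:K *: (2^-1 *: w)).
have t0cvg := @cvg_of_real_at_right R s.
have tN0 := @near_of_real_neq0 R s.
have xcvg : x t @[t --> (0 : R)^'+] --> (0 : 'rV[K]_n).
  rewrite -(scale0r u); apply: cvgZ; first exact: t0cvg.
  exact: (cvg_add_scale t0cvg (cvg_cst _)).
have phixcvg : phi (x t) @[t --> (0 : R)^'+] --> phi 0.
  exact: (cvg_comp x phi xcvg (analytic_map_continuous anphi V0)).
have dist0 : (t%:K ^+ 2)^-1 *: (phi (x t) - c t%:K) @[t --> (0 : R)^'+] --> (0
  : 'rV[K]_n).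
  apply: cvg_coordP => i; rewrite mxE.
  have Gcvg : (t%:K ^+ 2)^-1 * (phi (x t) 0 i - phi 0 0 i - t%:K * y1 0 i)
      @[t --> (0 : R)^'+] --> y2 0 i.
    rewrite [y2 0 i]mxE; apply: (cvg_trans (near_eq_cvg _)
      (cvg_second_order_quotient (u := u) (m := 1) (phiP i) t0cvg tN0
        (cvg_cst (2^-1 *: w)))).
    apply: nearW => t; rewrite big_nat1 expr0 mul1r expr1.
    by rewrite (power_series_expansion_coef0 _ (phiP i)) [y1 0 i]mxE.
  have : (t%:K ^+ 2)^-1 * (phi (x t) 0 i - phi 0 0 i - t%:K * y1 0 i) - y2 0 i
      @[t --> (0 : R)^'+] --> (0 : K).
    by rewrite -(subrr (y2 0 i)); apply: cvgB => //; exact: cvg_cst.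
  (* Stated over an abstract field, so that [field] meets only variables. *)
  have expand (L : fieldType) (tau a b p q : L) : tau != 0 ->
      (tau ^+ 2)^-1 * (a - (b + (tau * p + tau ^+ 2 * q))) =
      (tau ^+ 2)^-1 * (a - b - tau * p) - q by move=> ?; field.
  move=> G0; apply: (cvg_trans (near_eq_cvg _) G0); near=> t.
  have tau0 : t%:K != 0 :> K by near: t; exact: tN0.
  have -> : ((t%:K ^+ 2)^-1 *: (phi (x t) - c t%:K)) 0 i = (t%:K ^+ 2)^-1 *
      (phi (x t) 0 i - (phi 0 0 i + (t%:K * y1 0 i + t%:K ^+ 2 * y2 0 i))).
    by rewrite !mxE.
  exact/esym/expand.
apply: (cvg0_dominated (g := fun t => C * `|(t%:K ^+ 2)^-1 *: (phi (x t) - c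
  t%:K)|)).
  near=> t.
  have -> : t%:K *: u + (2^-1 * t ^+ 2)%:K *: w = x t
    by exact: second_order_point.
  have Vx : V (x t) by near: t; exact: xcvg nbhsV.
  have [_ psix] := phiK Vx.
  rewrite -{1}psix !normrZ mulrCA fmorphV rmorphXn ler_wpM2l// distrC.
  apply: psiC; near: t; [exact: phixcvg A0|exact: ccvg A0].
have := cvgMr (a := C) (cvg_norm dist0).
by rewrite normr0 mulr0; apply.
Unshelve. all: by end_near. Qed.

End SmoothPoint.

Theorem proposition4p3 (R : realType) (s : scalar_kind) (n : nat)
    (U X : set 'rV[scalars R s]_n)
    (oU : open U) (anX : analytic_set_in U X) (X0 : X 0)
    (smX : smooth_near_0 X) :
  (forall u, tangent_cone_0 X u -> u != 0 -> second_order_realizable X u) /\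
  (forall u, tangent_cone_0 X u -> u != 0 -> T2 X u = T2a X u).
Proof.
have real u : tangent_cone_0 X u -> u != 0 -> second_order_realizable X u.
  have [U' [d [oU' _ subm]]] := smX; have [_ U'0] := oU'.
  have [V [W [phi [psi [[oV oW] [anphi anpsi] phiK psiK phiX]]]]] := subm 0
    (conj X0 U'0).
  exact: (smooth_second_order_realizable oV oW anphi anpsi phiK psiK oU' X0
    phiX).
(* One inclusion holds for every set; realizability supplies the other. *)
split=> // u ucone uN0; apply/seteqP; split; first exact: T2_sub_T2a.
exact: second_order_realizable_T2a_sub (real u ucone uN0).
Qed.
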